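(* Let $(A,\rhd,\lhd)$ be a Leibniz-dendriform algebra, and let $L_\lhd,R_\rhd:A\to\mathfrak{gl}(A)$ be given by $L_\lhd(x)y=x\lhd y$, $R_\rhd(x)y=y\rhd x$. Then $(A;L_\lhd,R_\rhd)$ is a representation of the sub-adjacent Leibniz algebra $(A,[\cdot,\cdot]_{\rhd,\lhd})$. Moreover, the identity map $\mathrm{Id}:A\to A$ is a relative Rota–Baxter operator on the Leibniz algebra $(A,[\cdot,\cdot]_{\rhd,\lhd})$ with respect to the representation $(A;L_\lhd,R_\rhd)$.
   Context: All vector spaces are finite-dimensional over an algebraically closed field $\mathbb K$ of characteristic $0$. A Leibniz algebra is a vector space with a bilinear operation satisfying $[x,[y,z]]=[[x,y],z]+[y,[x,z]]$. A representation of a Leibniz algebra $\mathfrak g$ is $(V;\rho^L,\rho^R)$ with linear maps $\rho^L,\rho^R:\mathfrak g\to\mathfrak{gl}(V)$ such that $\rho^L([x,y])=[\rho^L(x),\rho^L(y)]$, $\rho^R([x,y])=[\rho^L(x),\rho^R(y)]$, $\rho^R(y)\rho^L(x)=-\rho^R(y)\rho^R(x)$. A relative Rota–Baxter operator on $\mathfrak g$ with respect to $(V;\rho^L,\rho^R)$ is a linear map $K:V\to\mathfrak g$ with $[Kv_1,Kv_2]_{\mathfrak g}=K(\rho^L(Kv_1)v_2+\rho^R(Kv_2)v_1)$ for all $v_1,v_2\in V$. A Leibniz-dendriform algebra is a vector space $A$ with two bilinear operations $\rhd,\lhd$ such that for all $x,y,z\in A$: $(x\lhd y)\lhd z=x\lhd(y\lhd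 z)-y\lhd(x\lhd z)-(x\rhd y)\lhd z$; $x\lhd(y\rhd z)=(x\lhd y)\rhd z+y\rhd(x\lhd z)+y\rhd(x\rhd z)$; $x\rhd(y\rhd z)=(x\rhd y)\rhd z+y\lhd(x\rhd z)-x\rhd(y\lhd z)$. Its sub-adjacent Leibniz algebra is $A$ with the bracket $[x,y]_{\rhd,\lhd}=x\lhd y+x\rhd y$ (which is a Leibniz bracket). *)

(* Defs.v *)
From HB Require Import structures.
From mathcomp Require Import all_boot all_order all_algebra.

Set Implicit Arguments.
Unset Strict Implicit.
Unset Printing Implicit Defensive.

Import GRing.Theory.
Local Open Scope ring_scope.

Section Leibniz.
Variable F : fieldType.

Record leibniz_algebra (A : vectType F) := LeibnizAlgebra {
  bracket : {bilinear A -> A -> A};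
  bracket_leibniz : forall x y z : A,
    bracket x (bracket y z) = bracket (bracket x y) z + bracket y (bracket x z)
}.

(* The Lie bracket of gl(V); the ring structure on 'End(V) exists only for
   V != 0, hence the use of \o%VF. *)
Definition commutator (V : vectType F) (f g : 'End(V)) : 'End(V) :=
  (f \o g)%VF - (g \o f)%VF.

Definition is_representation (A V : vectType F) (g : leibniz_algebra A)
    (rhoL rhoR : {linear A -> 'End(V)}) : Prop :=
  [/\ forall x y : A, rhoL (bracket g x y) = commutator (rhoL x) (rhoL y),
      forall x y : A, rhoR (bracket g x y) = commutator (rhoL x) (rhoR y)
    & forall x y : A, (rhoR y \o rhoL x)%VF = - (rhoR y \o rhoR x)%VF].

Definition is_relative_Rota_Baxter (A V : vectType F) (g : leibniz_algebra A)
    (rhoL rhoR : {linear A -> 'End(V)}) (K : 'Hom(V, A)) : Prop :=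
  forall v1 v2 : V,
    bracket g (K v1) (K v2) = K (rhoL (K v1) v2 + rhoR (K v2) v1).

(* [rhd x y] is x |> y and [lhd x y] is x <| y. *)
Record leibniz_dendriform (A : vectType F) := LeibnizDendriform {
  rhd : {bilinear A -> A -> A};
  lhd : {bilinear A -> A -> A};
  lhd_lhdl : forall x y z : A,
    lhd (lhd x y) z = lhd x (lhd y z) - lhd y (lhd x z) - lhd (rhd x y) z;
  lhd_rhdr : forall x y z : A,
    lhd x (rhd y z) = rhd (lhd x y) z + rhd y (lhd x z) + rhd y (rhd x z);
  rhd_rhdr : forall x y z : A,
    rhd x (rhd y z) = rhd (rhd x y) z + lhd y (rhd x z) - rhd x (lhd y z)
}.

Section SubAdjacent.
Variables (A : vectType F) (D : leibniz_dendriform A).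

Definition sub_bracket (x y : A) : A := lhd D x y + rhd D x y.

Fact sub_bracket_is_bilinear : bilinear_for *:%R *:%R sub_bracket.
Proof.
split=> u a x y; rewrite /sub_bracket.
  by rewrite !linearPl /= scalerDr addrACA.
by rewrite !linearPr /= scalerDr addrACA.
Qed.

HB.instance Definition _ := bilinear_isBilinear.Build F A A A *:%R *:%R
  sub_bracket sub_bracket_is_bilinear.

Fact sub_bracket_leibniz (x y z : A) :
  sub_bracket x (sub_bracket y z) =
  sub_bracket (sub_bracket x y) z + sub_bracket y (sub_bracket x z).
Proof.
rewrite /sub_bracket !linearDl !linearDr /=.
rewrite lhd_lhdl (lhd_rhdr D x y z) (rhd_rhdr D x y z) subrK.
rewrite [rhd D x (lhd D y z) + _]addrC subrK.
set a := lhd D x (lhd D y z); set b := lhd D y (lhd D x z).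
set p := rhd D (lhd D x y) z; set q := rhd D y (lhd D x z).
set r := rhd D y (rhd D x z); set s := rhd D (rhd D x y) z.
set t := lhd D y (rhd D x z).
rewrite [RHS](AC (2*2*(2*2)) (1*(3*7*8)*(4*6)*(2*5)))/= addNr addr0.
by rewrite -!addrA.
Qed.

Definition sub_adjacent : leibniz_algebra A :=
  LeibnizAlgebra sub_bracket_leibniz.

Definition lmul_lhd (x : A) : 'End(A) := linfun (lhd D x).

Definition rmul_rhd (x : A) : 'End(A) := linfun (applyr (rhd D) x).

Lemma lmul_lhdE (x y : A) : lmul_lhd x y = lhd D x y.
Proof. exact: lfunE. Qed.

Lemma rmul_rhdE (x y : A) : rmul_rhd x y = rhd D y x.
Proof. exact: lfunE. Qed.

Fact lmul_lhd_is_linear : linear lmul_lhd.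
Proof.
by move=> a x y; apply/lfunP=> z; rewrite add_lfunE scale_lfunE !lmul_lhdE linearPl.
Qed.

HB.instance Definition _ :=
  GRing.isLinear.Build F A 'End(A) *:%R lmul_lhd lmul_lhd_is_linear.

Fact rmul_rhd_is_linear : linear rmul_rhd.
Proof.
by move=> a x y; apply/lfunP=> z; rewrite add_lfunE scale_lfunE !rmul_rhdE linearPr.
Qed.

HB.instance Definition _ :=
  GRing.isLinear.Build F A 'End(A) *:%R rmul_rhd rmul_rhd_is_linear.

End SubAdjacent.
End Leibniz.

(* Main.v *)
Require Import Defs.
From mathcomp Require Import all_boot all_order all_algebra.
Import GRing.Theory.
Local Open Scope ring_scope.

(** Evaluated at a vector, the first two representation identities are the first two dendriform
    axioms rearranged; the third follows from the last two axioms by [rhd_lhd_rhdl]. For the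
    identity map, the Rota-Baxter equation is the definition of the bracket. *)

(* Substituting the third dendriform axiom, with x and y exchanged, for the last
   term of the second one cancels everything but the two terms below. *)
Lemma rhd_lhd_rhdl (F : fieldType) (A : vectType F) (D : leibniz_dendriform A)
    (x y z : A) : rhd D (lhd D x y) z = - rhd D (rhd D y x) z.
Proof.
apply/eqP; rewrite -addr_eq0; apply/eqP.
have := lhd_rhdr D x y z; rewrite (rhd_rhdr D y x z).
set p := rhd D (lhd D x y) z; set q := rhd D y (lhd D x z).
set r := rhd D (rhd D y x) z; set s := lhd D x (rhd D y z) => E.
(* [s] is on both sides of [E]: once it is added to the goal, expanding only the right-hand [s]
   leaves [q - q] to cancel. *)
apply: (addIr s); rewrite add0r {2}E.
by rewrite [RHS](AC (2*3) (2*5*(1*3*4)))/= subrr add0r.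
Qed.

Theorem proposition5p6 (K : closedFieldType) (charK : [pchar K] =i pred0)
    (A : vectType K) (D : leibniz_dendriform A) :
  is_representation (sub_adjacent D) (lmul_lhd D) (rmul_rhd D) /\
  is_relative_Rota_Baxter (sub_adjacent D) (lmul_lhd D) (rmul_rhd D)
    (\1%VF : 'Hom(A, A)).
Proof.
split; last by move=> v1 v2; rewrite !id_lfunE /= lmul_lhdE rmul_rhdE.
split=> x y; apply/lfunP=> z /=.
- rewrite /commutator add_lfunE opp_lfunE !comp_lfunE !lmul_lhdE.
  by rewrite /sub_bracket linearDl /= lhd_lhdl subrK.
- rewrite /commutator add_lfunE opp_lfunE !comp_lfunE !lmul_lhdE !rmul_rhdE.
  (* The second axiom at [x], [z], [y], solved for its last two terms. *)
  by rewrite /sub_bracket linearDr /= lhd_rhdr -[X in X - _]addrA [RHS]addrC addKr.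
by rewrite opp_lfunE !comp_lfunE !lmul_lhdE !rmul_rhdE rhd_lhd_rhdl.
Qed.
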